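(* Let $X\sim\mathcal N(0,\sigma_1^2)$ and $X_T\sim\mathcal N(0,\sigma_2^2)$ be independent, with $\sigma_1,\sigma_2>0$, and fix a clipping range $L>0$. For $Q\in\{1,\dots,8\}$ let $\operatorname{quantize}_Q$ be the $Q$-bit symmetric uniform quantizer on $[-L,L]$: it first clips $x$ to $[-L,L]$ and then rounds to the nearest of the $2^Q$ equally spaced levels $-L+\frac{2Lm}{2^Q-1}$, $m=0,1,\dots,2^Q-1$ (so $\operatorname{quantize}_1(x)=L\operatorname{sign}(x)$). Define the proportion of optimization direction error $$p_{\mathrm{error}}(Q)=P\big(\operatorname{sign}(X-X_T)\neq \operatorname{sign}(\operatorname{quantize}_Q(X)-X_T)\big).$$ Then $p_{\mathrm{error}}(Q)$ becomes larger as $Q$ decreases from $8$ to $1$; that is, $p_{\mathrm{error}}(Q)$ is decreasing in $Q$ on $\{1,\dots,8\}$.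
   Context: $\operatorname{sign}(x)=1$ if $x\ge 0$ and $-1$ otherwise. *)

(* Defs.v *)
From HB Require Import structures.
From mathcomp Require Import all_boot all_order all_algebra.
From mathcomp Require Import all_classical all_reals all_analysis.
Set Implicit Arguments. Unset Strict Implicit. Unset Printing Implicit Defensive.
Import Order.TTheory GRing.Theory Num.Theory.
Local Open Scope classical_set_scope.
Local Open Scope ring_scope.

Section defs.
Context {R : realType}.

Definition sgn (x : R) : R := if 0 <= x then 1 else -1.

Definition clip (L x : R) : R := Num.min (Num.max x (- L)) L.

(* Q-bit symmetric uniform quantizer on [-L,L]: clip, then round to the
   nearest level -L + 2 L m / (2^Q - 1), m = 0..2^Q-1 (ties rounded up). *)
Definition quantize (Q : nat) (L x : R) : R :=
  let N : R := (2 ^ Q - 1)%N%:R in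
  let t := (clip L x + L) * N / (2 * L) in
  let m := Num.floor (t + 2^-1) in
  - L + 2 * L * m%:~R / N.

(* p_error(Q) = P(sign(X - X_T) <> sign(quantize_Q X - X_T)) where
   (X, X_T) has law N(0,s1^2) (x) N(0,s2^2) (independence). *)
Definition p_error (s1 s2 L : R) (Q : nat) : \bar R :=
  ((normal_prob 0 s1 \x normal_prob 0 s2)
     [set z : R * R | sgn (z.1 - z.2) != sgn (quantize Q L z.1 - z.2)])%E.

End defs.

(* Main.v *)
Require Import Defs.
From HB Require Import structures.
From mathcomp Require Import all_boot all_order all_algebra.
From mathcomp Require Import all_classical all_reals all_analysis.
From mathcomp Require Import measurable_realfun.
From mathcomp Require Import ring lra zify.
Import Order.TTheory GRing.Theory Num.Theory.
Set Implicit Arguments.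
Unset Strict Implicit.
Unset Printing Implicit Defensive.
Local Open Scope classical_set_scope.
Local Open Scope ring_scope.

(* On [x >= 0] the error event of the quantizer with [N = 2^Q - 1] steps consists
   of a tail [x > L] that does not depend on [Q] and of [N] right triangles with
   legs [L / N], strung along the diagonal of [[0, L]^2] and lying alternately above
   and below it; on [x < 0] it is the mirror image.  Both Gaussian densities
   decrease away from [0], so translating a subset of the positive quadrant towards
   the origin does not decrease its mass.  Passing from [Q] to [Q + 1] replaces [N]
   triangles by [2 N + 1] triangles whose legs are less than half as long, and these
   can be translated towards the origin so that they fit, without overlap, into the
   [N] large ones, leaving a set of positive mass uncovered. *)

(** * Centred Gaussian laws on the line: translation, reflection, positivity *)

Section gaussian_mass.
Context {R : realType}.
Implicit Types (s c : R) (B : set (measurableTypeR R)).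

Lemma measurable_subr c :
  measurable_fun setT ((fun x => x - c) : measurableTypeR R -> measurableTypeR R).
Proof. exact: measurable_funB. Qed.

(** Lebesgue measure is determined by its values on intervals []a, b]], whose length a translation
    keeps. *)
Lemma lebesgue_measure_shift c B : measurable B ->
  pushforward lebesgue_measure
    ((fun x => x - c) : measurableTypeR R -> measurableTypeR R) B
  = lebesgue_measure B.
Proof.
move=> mB; apply/esym.
have mm := measurable_subr c.
pose mphi : {mfun measurableTypeR R >-> measurableTypeR R} :=
  HB.pack (_ : measurableTypeR R -> measurableTypeR R)
    (isMeasurableFun.Build _ _ _ _ _ mm).
apply: (@lebesgue_measure_unique R (pushforward lebesgue_measure mphi))
  => // _ [[a b]] _ <-.
rewrite /= /pushforward.
have -> : mphi @^-1` `]a, b] = `]a + c, b + c]%classic.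
  by apply/seteqP; split => x /=; rewrite !in_itv/= ltrBrDr lerBlDr.
rewrite !lebesgue_measure_itv/= !lte_fin ltrD2r.
by case: ifP => // _; rewrite -!EFinB; congr EFin; ring.
Qed.

Lemma normal_prob_shift s c B : measurable B ->
  normal_prob 0 s [set x | B (x - c)] =
  (\int[lebesgue_measure]_(x in B) (normal_pdf 0 s (x + c)%R)%:E)%E.
Proof.
move=> mB.
have mphi := measurable_subr c.
transitivity (\int[pushforward lebesgue_measure
    ((fun x => x - c)%R : measurableTypeR R -> measurableTypeR R)]_(x in B)
    (normal_pdf 0 s (x + c)%R)%:E)%E; last first.
  by apply: eq_measure_integral => A mA _; exact: lebesgue_measure_shift.
rewrite ge0_integral_pushforward//=.
- by apply: eq_integral => x _ /=; rewrite subrK.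
- apply/measurable_EFinP; apply: measurable_funTS.
  apply: (measurableT_comp (measurable_normal_pdf 0 s)).
  exact: measurable_funD.
- by move=> x _; rewrite lee_fin normal_pdf_ge0.
Qed.

Lemma normal_pdf0_nonincreasing s (x y : R) :
  s != 0 -> `|x| <= `|y| -> normal_pdf 0 s y <= normal_pdf 0 s x.
Proof.
move=> s0 xy; rewrite !normal_pdfE// ler_wpM2l ?normal_peak_ge0//.
rewrite /normal_fun ler_expR !subr0 ler_wpM2r//.
  by rewrite invr_ge0 mulrn_wge0// sqr_ge0.
rewrite lerN2 -(real_normK (num_real x)) -(real_normK (num_real y)).
by rewrite lerXn2r ?nnegrE.
Qed.

(** For [x >= 0] the point [x + c] is farther from the mode, so the translated density is pointwise
    smaller on [B]. *)
Lemma normal_prob_shift_le s c B : s != 0 -> 0 <= c ->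
  measurable B -> B `<=` [set x | 0 <= x] ->
  (normal_prob 0 s [set x | B (x - c)%R] <= normal_prob 0 s B)%E.
Proof.
move=> s0 c0 mB B0; rewrite normal_prob_shift//.
apply: ge0_le_integral => //=.
- by move=> x _; rewrite lee_fin normal_pdf_ge0.
- apply/measurable_EFinP; apply: measurable_funTS.
  apply: (measurableT_comp (measurable_normal_pdf 0 s)).
  exact: measurable_funD.
- by apply/measurable_EFinP; apply: measurable_funTS; exact: measurable_normal_pdf.
- move=> x Bx; have x0 : 0 <= x := B0 _ Bx.
  rewrite lee_fin normal_pdf0_nonincreasing//.
  by rewrite !ger0_norm ?addr_ge0// lerDl.
Qed.

Lemma normal_probN s B : s != 0 -> measurable B ->
  normal_prob 0 s [set x | B (- x)] = normal_prob 0 s B.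
Proof.
move=> s0 mB; rewrite /normal_prob.
transitivity (\int[pushforward lebesgue_measure
    (-%R : measurableTypeR R -> measurableTypeR R)]_(x in B)
    (normal_pdf 0 s (- x)%R)%:E)%E; last first.
  rewrite (_ : (fun x => _) = (fun x => (normal_pdf 0 s x)%:E)); last first.
    apply/funext => x; congr EFin.
    by rewrite !normal_pdfE// /normal_fun !subr0 sqrrN.
  by apply: eq_measure_integral => A mA _; exact: lebesgue_measureN.
rewrite ge0_integral_pushforward//=.
- by apply: eq_integral => x _ /=; rewrite opprK.
- apply/measurable_EFinP; apply: measurable_funTS.
  exact: (measurableT_comp (measurable_normal_pdf 0 s)).
- by move=> x _; rewrite lee_fin normal_pdf_ge0.
Qed.

(** On the interval the density is at least its positive value at the larger of [|a|] and [|b|]. *)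
Lemma normal_prob_itv_gt0 s (a b : R) : s != 0 -> a < b ->
  (0 < normal_prob 0 s `]a, b[%classic)%E.
Proof.
move=> s0 ab; set M := Num.max `|a| `|b|.
have M0 : 0 < normal_pdf 0 s M.
  by rewrite normal_pdfE// mulr_gt0 ?normal_peak_gt0// expR_gt0.
apply: (@lt_le_trans _ _
  (\int[lebesgue_measure]_(x in `]a, b[) (cst (normal_pdf 0 s M)%:E x))%E).
  rewrite integral_cst//= lebesgue_measure_itv/= lte_fin ab -EFinB -EFinM lte_fin.
  by rewrite mulr_gt0// subr_gt0.
apply: ge0_le_integral => //=.
- by move=> x _; rewrite lee_fin normal_pdf_ge0.
- by apply/measurable_EFinP; apply: measurable_funTS; exact: measurable_normal_pdf.
- move=> x; rewrite in_itv/= => /andP[ax xb].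
  rewrite lee_fin normal_pdf0_nonincreasing//.
  rewrite [leRHS]ger0_norm ?le_max ?normr_ge0//.
  have [x0|x0] := leP 0 x; apply/orP; [right|left].
    by rewrite !ger0_norm//; [exact: ltW|exact: (le_trans x0 (ltW xb))].
  by rewrite !ltr0_norm ?lerN2 ?ltW// (lt_trans ax).
Qed.

End gaussian_mass.

(** * Product measures, one coordinate at a time *)

Section product_mass.
Context {R : realType}.
Variables (P1 P2 : probability (measurableTypeR R) R).
Local Notation T := (measurableTypeR R).

(** The product is defined through x-sections; uniqueness gives the other order of integration,
    needed to act on the first coordinate. *)
Lemma product_measure_ysection (A : set (T * T)) : measurable A ->
  ((P1 \x P2) A = \int[P2]_y P1 (ysection A y))%E.
Proof.
move=> mA; rewrite (product_measure_unique (m' := product_measure2 P1 P2))//.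
by move=> B C mB mC; rewrite /= product_measure2E.
Qed.

Lemma product_prob_preimage_le (f g : T -> T) (D1 D2 : set T) (A : set (T * T)) :
  measurable_fun setT f -> measurable_fun setT g ->
  (forall B, measurable B -> B `<=` D1 -> P1 (f @^-1` B) <= P1 B)%E ->
  (forall B, measurable B -> B `<=` D2 -> P2 (g @^-1` B) <= P2 B)%E ->
  measurable A -> A `<=` D1 `*` D2 ->
  ((P1 \x P2) [set z | A (f z.1, g z.2)] <= (P1 \x P2) A)%E.
Proof.
move=> mf mg Hf Hg mA AD.
have mA1 : measurable [set z : T * T | A (z.1, g z.2)].
  rewrite -[X in measurable X]setTI.
  apply: (_ : measurable_fun setT (fun z : T * T => (z.1, g z.2) : T * T)) => //.
  apply: measurable_fun_pair => //; exact: measurableT_comp.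
have mA2 : measurable [set z : T * T | A (f z.1, g z.2)].
  rewrite -[X in measurable X]setTI.
  apply: (_ : measurable_fun setT (fun z : T * T => (f z.1, g z.2) : T * T)) => //.
  by apply: measurable_fun_pair => //; exact: measurableT_comp.
(* Undo [f] inside the y-sections first, then [g] inside the x-sections. *)
apply: (@le_trans _ _ ((P1 \x P2)%E [set z | A (z.1, g z.2)])).
  rewrite !product_measure_ysection//.
  apply: ge0_le_integral => //=.
  - exact: (measurable_fun_ysection P1 mA2).
  - exact: (measurable_fun_ysection P1 mA1).
  - move=> y _; rewrite !ysectionE.
    apply: (Hf [set x | A (x, g y)]).
      by have := measurable_ysection y mA1; rewrite ysectionE.
    by move=> x /= /AD[].
apply: ge0_le_integral => //=.
- exact: (measurable_fun_xsection P2 mA1).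
- exact: (measurable_fun_xsection P2 mA).
- move=> x _; rewrite !xsectionE.
  apply: (Hg [set y | A (x, y)]).
    by have := measurable_xsection x mA; rewrite xsectionE.
  by move=> y /= /AD[].
Qed.

End product_mass.

(** * Measurability of weak and strict comparisons *)

Section lteif_measurable.
Context d (T : measurableType d) (R : realType).

Lemma measurable_lteif (b : bool) (f g : T -> R) :
  measurable_fun setT f -> measurable_fun setT g ->
  measurable [set x | f x < g x ?<= if b].
Proof.
move=> mf mg; case: b => /=.
- have /(_ measurableT [set true]) := measurable_fun_ler mf mg.
  by rewrite setTI preimage_true; exact.
- have /(_ measurableT [set true]) := measurable_fun_ltr mf mg.
  by rewrite setTI preimage_true; exact.
Qed.

End lteif_measurable.

(** * Right isosceles triangles *)

Section triangles.
Context {R : realType}.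
Local Notation T := (measurableTypeR R).
Implicit Types (b : bool) (c d s h : R).

(* Right isosceles triangles with legs of length [s] and corner [(c, d)], above
   and below the line through the corner of slope one.  The boolean fixes which
   sides are included: [true] is what rounding ties up produces for [x >= 0], and
   [false] its image under [z |-> - z] for [x < 0]. *)
Definition upper_tri b c d s : set (T * T) :=
  [set z | [/\ c < z.1 ?<= if b, z.1 - c < z.2 - d ?<= if ~~ b
             & z.2 < d + s ?<= if b]].

Definition lower_tri b c d s : set (T * T) :=
  [set z | [/\ d < z.2 ?<= if ~~ b, z.2 - d < z.1 - c ?<= if b
             & z.1 < c + s ?<= if ~~ b]].

Lemma measurable_upper_tri b c d s : measurable (upper_tri b c d s).
Proof.
rewrite (_ : upper_tri b c d s =
  [set z : T * T | c < z.1 ?<= if b] `&`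
  [set z : T * T | z.1 - c < z.2 - d ?<= if ~~ b] `&`
  [set z : T * T | z.2 < d + s ?<= if b]); last first.
  by apply/seteqP; split => [z [] | z [[]]].
apply: measurableI; first apply: measurableI.
- exact: measurable_lteif.
- by apply: measurable_lteif; apply: measurable_funB.
- exact: measurable_lteif.
Qed.

Lemma measurable_lower_tri b c d s : measurable (lower_tri b c d s).
Proof.
rewrite (_ : lower_tri b c d s =
  [set z : T * T | d < z.2 ?<= if ~~ b] `&`
  [set z : T * T | z.2 - d < z.1 - c ?<= if b] `&`
  [set z : T * T | z.1 < c + s ?<= if ~~ b]); last first.
  by apply/seteqP; split => [z [] | z [[]]].
apply: measurableI; first apply: measurableI.
- exact: measurable_lteif.
- by apply: measurable_lteif; apply: measurable_funB.
- exact: measurable_lteif.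
Qed.

End triangles.

(** * Gaussian mass in the plane: moving and subdividing triangles *)

Section mass.
Context {R : realType}.
Local Notation T := (measurableTypeR R).
Variables (s1 s2 : R).
Hypotheses (s1_neq0 : s1 != 0) (s2_neq0 : s2 != 0).
Local Notation mu := (normal_prob 0 s1 \x normal_prob 0 s2)%E.
Implicit Types (A B C : set (T * T)) (b : bool) (c d s h : R).

(* Locked: otherwise unification unfolds the integrals. *)
Definition mass (t1 t2 : R) : set (T * T) -> R :=
  locked (fun A => fine ((normal_prob 0 t1 \x normal_prob 0 t2)%E A)).
Local Notation m := (mass s1 s2).

Lemma massE A : measurable A -> mu A = (m A)%:E.
Proof.
move=> mA; rewrite /mass -lock fineK//.
exact: (fin_num_measure (mu : probability _ _)).
Qed.

Lemma mass_le_measure A B : measurable A -> measurable B -> (mu A <= mu B)%E ->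
  m A <= m B.
Proof.
move=> mA mB; rewrite /mass -lock; apply: fine_le;
  exact: (fin_num_measure (mu : probability _ _)).
Qed.

Lemma mass_subset A B : measurable A -> measurable B -> A `<=` B -> m A <= m B.
Proof.
by move=> mA mB AB; apply: (mass_le_measure mA mB); apply: le_measure; rewrite ?inE.
Qed.

Lemma massU A B : measurable A -> measurable B -> A `&` B = set0 ->
  m (A `|` B) = m A + m B.
Proof.
move=> mA mB AB; apply: EFin_inj; rewrite EFinD -(massE mA) -(massE mB).
rewrite -(massE (measurableU _ _ mA mB)); exact: measureU.
Qed.

(** The set on the left is [A] pushed away from the origin by [(c, d)]; each coordinate can only
    lose mass. *)
Lemma mass_shift_le A (c d : R) : 0 <= c -> 0 <= d -> measurable A ->
  A `<=` [set z | 0 <= z.1 /\ 0 <= z.2] ->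
  m [set z | A (z.1 - c, z.2 - d)] <= m A.
Proof.
move=> c0 d0 mA A0.
have mA' : measurable ([set z | A (z.1 - c, z.2 - d)] : set (T * T)).
  rewrite -[X in measurable X]setTI.
  apply: (_ : measurable_fun setT (fun z : T * T => (z.1 - c, z.2 - d) : T * T)) => //.
  by apply: measurable_fun_pair => //; exact: measurable_funB.
apply: (mass_le_measure mA' mA).
apply: (@product_prob_preimage_le R (normal_prob 0 s1) (normal_prob 0 s2)
  (fun x => x - c) (fun x => x - d) [set x | 0 <= x] [set x | 0 <= x]) => //.
- exact: measurable_subr.
- exact: measurable_subr.
- by move=> B mB B0; exact: normal_prob_shift_le.
- by move=> B mB B0; exact: normal_prob_shift_le.
Qed.

Lemma measurable_preimageN A : measurable A ->
  measurable ([set z | A (- z.1, - z.2)] : set (T * T)).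
Proof.
move=> mA; rewrite -[X in measurable X]setTI.
apply: (_ : measurable_fun setT (fun z : T * T => (- z.1, - z.2) : T * T)) => //.
by apply: measurable_fun_pair => //; exact: measurableT_comp.
Qed.

Lemma massN A : measurable A -> m [set z | A (- z.1, - z.2)] = m A.
Proof.
have mN := measurable_preimageN.
have le B : measurable B -> m [set z | B (- z.1, - z.2)] <= m B.
  move=> mB; apply: (mass_le_measure (mN _ mB) mB).
  apply: (@product_prob_preimage_le R (normal_prob 0 s1) (normal_prob 0 s2)
    (fun x => - x) (fun x => - x) setT setT) => //.
  - exact: oppr_measurable.
  - exact: oppr_measurable.
  - by move=> C mC _; rewrite -[leRHS](normal_probN s1_neq0 mC).
  - by move=> C mC _; rewrite -[leRHS](normal_probN s2_neq0 mC).
(* Negation is an involution, so the inequality applied to the reflected set gives the converse. *)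
move=> mA; apply/eqP; rewrite eq_le le//=.
have := le _ (mN _ mA); congr (_ <= _); congr (m _).
by apply/funext => -[x y] /=; rewrite !opprK.
Qed.

Lemma mass_rectangle_gt0 (a b c d : R) : a < b -> c < d ->
  0 < m (`]a, b[ `*` `]c, d[).
Proof.
move=> ab cd; rewrite -lte_fin -massE; last exact: measurableX.
by rewrite product_measure1E// mule_gt0//; exact: normal_prob_itv_gt0.
Qed.

Lemma mass_upper_tri_le b c d c' d' s : 0 <= c -> 0 <= d -> c <= c' -> d <= d' ->
  m (upper_tri b c' d' s) <= m (upper_tri b c d s).
Proof.
move=> c0 d0 cc dd.
have -> : upper_tri b c' d' s =
    [set z | upper_tri b c d s (z.1 - (c' - c), z.2 - (d' - d))].
  apply/seteqP; split => -[x y]; rewrite /upper_tri /=;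
    by case: b => /= -[*]; split; lra.
apply: mass_shift_le; rewrite ?subr_ge0//; first exact: measurable_upper_tri.
by move=> [x y]; rewrite /upper_tri; case: b => /= -[*]; split; lra.
Qed.

Lemma mass_lower_tri_le b c d c' d' s : 0 <= c -> 0 <= d -> c <= c' -> d <= d' ->
  m (lower_tri b c' d' s) <= m (lower_tri b c d s).
Proof.
move=> c0 d0 cc dd.
have -> : lower_tri b c' d' s =
    [set z | lower_tri b c d s (z.1 - (c' - c), z.2 - (d' - d))].
  apply/seteqP; split => -[x y]; rewrite /lower_tri /=;
    by case: b => /= -[*]; split; lra.
apply: mass_shift_le; rewrite ?subr_ge0//; first exact: measurable_lower_tri.
by move=> [x y]; rewrite /lower_tri; case: b => /= -[*]; split; lra.
Qed.

Lemma mass3_le A B C D : measurable A -> measurable B -> measurable C ->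
  measurable D -> A `&` B = set0 -> (A `|` B) `&` C = set0 ->
  A `|` B `|` C `<=` D -> m A + m B + m C <= m D.
Proof.
move=> mA mB mC mD AB ABC ABCD.
rewrite -massU// -massU//; last exact: measurableU.
by apply: mass_subset => //; do 2?apply: measurableU.
Qed.

(** Joining midpoints cuts a triangle of leg [2 * s] into four of leg [s]; these are three of them,
    the fourth having corner [(c + s, c)]. *)
Lemma mass_lower_tri_split b c s h : 0 < s -> 2 * s <= h ->
  m (lower_tri b c c s) + m (upper_tri b (c + s) c s) +
  m (lower_tri b (c + s) (c + s) s) <= m (lower_tri b c c h).
Proof.
move=> s0 sh; apply: mass3_le;
  do ?[exact: measurable_lower_tri|exact: measurable_upper_tri].
- apply/seteqP; split => -[x y] //; rewrite /upper_tri /lower_tri.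
  by case: b => /= -[[? ? ?] [? ? ?]]; lra.
- apply/seteqP; split => -[x y] //; rewrite /upper_tri /lower_tri.
  by case: b => /= -[[] [? ? ?] [? ? ?]]; lra.
- move=> [x y]; rewrite /upper_tri /lower_tri.
  by case: b => /= -[[]|] [? ? ?]; split; lra.
Qed.

Lemma mass_upper_tri_split b s h : 0 < s -> 2 * s <= h ->
  m (upper_tri b 0 0 s) + m (lower_tri b 0 s s) + m (upper_tri b s s s)
    < m (upper_tri b 0 0 h).
Proof.
move=> s0 sh.
(* [K] lies in the fourth piece, the upper triangle with corner [(0, s)]; its positive mass makes
   the inequality strict. *)
pose K : set (T * T) := `]0, s / 2[ `*` `]3 * s / 2, 2 * s[.
have mK : measurable K by exact: measurableX.
have K0 : 0 < m K by apply: mass_rectangle_gt0; lra.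
have mU : measurable (upper_tri b 0 0 h `\` K).
  by apply: measurableD => //; exact: measurable_upper_tri.
have -> : m (upper_tri b 0 0 h) = m (upper_tri b 0 0 h `\` K) + m K.
  rewrite -massU//; last by apply/seteqP; split => // z [[]].
  congr (m _); rewrite setUC setDUK//.
  move=> [x y]; rewrite /K /upper_tri /= !in_itv /= => -[/andP[? ?] /andP[? ?]].
  by clear mU; case: b => /=; split; lra.
apply: (@le_lt_trans _ _ (m (upper_tri b 0 0 h `\` K))); last by rewrite ltrDl.
apply: mass3_le => //;
  do ?[exact: measurable_lower_tri|exact: measurable_upper_tri].
- apply/seteqP; split => -[x y] //; rewrite /upper_tri /lower_tri.
  by clear mU; case: b => /= -[[? ? ?] [? ? ?]]; lra.
- apply/seteqP; split => -[x y] //; rewrite /upper_tri /lower_tri.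
  by clear mU; case: b => /= -[[] [? ? ?] [? ? ?]]; lra.
- move=> [x y]; rewrite /upper_tri /lower_tri /K /=; clear mU; case: b => /= H; split.
  all: do 1?[by case: H => [[]|] [? ? ?]; split; lra].
  all: rewrite !in_itv /= => -[/andP[? ?] /andP[? ?]].
  all: by case: H => [[]|] [? ? ?]; lra.
Qed.

Lemma mass_upper_triS b c d s h : s <= h ->
  m (upper_tri b c d s) <= m (upper_tri b c d h).
Proof.
move=> sh; apply: mass_subset; do ?exact: measurable_upper_tri.
by move=> [x y]; rewrite /upper_tri; case: b => /= -[? ? ?]; split; lra.
Qed.

End mass.

(** * Comparing the chains of triangles of two step sizes *)

Section alternating_sum.
Context {R : realType}.
Local Notation T := (measurableTypeR R).
Implicit Types (b : bool) (h : R).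

(** A quantization cell has width [2 * h]. On its first half (even [j]) the level exceeds x, so
    errors lie above the diagonal; on its second half, below. *)
Definition alt_tri b h (j : nat) : set (T * T) :=
  if odd j then lower_tri b (j%:R * h) (j%:R * h) h
  else upper_tri b (j%:R * h) (j%:R * h) h.

Lemma measurable_alt_tri b h j : measurable (alt_tri b h j).
Proof.
rewrite /alt_tri; case: ifP => _.
  exact: measurable_lower_tri.
exact: measurable_upper_tri.
Qed.

Lemma sum_ord_pairs (M : nat) (F : nat -> R) :
  \sum_(j < (2 * M).+1) F j =
  F 0%N + \sum_(i < M) (F (2 * i).+1 + F (2 * i).+2).
Proof.
elim: M => [|M IH]; first by rewrite big_ord1 big_ord0 addr0.
rewrite mulnS !addSn add0n 2!big_ord_recr/= IH [in RHS]big_ord_recr/=.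
by rewrite !addrA.
Qed.

(** Matches [sum_ord_pairs]: three small triangles for the first large one, then four for each
    pair. *)
Lemma sum_ord_quads (M : nat) (F : nat -> R) :
  \sum_(j < (4 * M).+3) F j =
  F 0%N + F 1%N + F 2%N +
  \sum_(i < M) (F (4 * i).+3 + F (4 * i).+4 + F (4 * i).+4.+1 + F (4 * i).+4.+2).
Proof.
elim: M => [|M IH]; first by rewrite !big_ord_recr !big_ord0/= add0r addr0.
rewrite mulnS !addSn add0n 4!big_ord_recr/= IH [in RHS]big_ord_recr/=.
by rewrite !addrA.
Qed.

Variables (s1 s2 : R).
Hypotheses (s1_neq0 : s1 != 0) (s2_neq0 : s2 != 0).
Local Notation m := (mass s1 s2).

(* Each small triangle is translated towards the origin, which does not decrease
   its mass, into a large one: triangles [0, 1, 2] into triangle [0], triangles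
   [4i+3, 4i+4, 4i+5] into triangle [2i+1], and triangle [4i+6] into [2i+2]. *)
Lemma sum_alt_tri_lt b (M : nat) (h h' : R) : 0 < h' ->
  (2 * M%:R + 1) * h = (4 * M%:R + 3) * h' ->
  \sum_(j < (4 * M).+3) m (alt_tri b h' j) <
  \sum_(j < (2 * M).+1) m (alt_tri b h j).
Proof.
move=> h'0 hh'.
(* The room left in a large leg by two small ones; over all [2 * M + 1] large legs it adds up to one
   [h']. *)
pose e := h - 2 * h'.
have eM : (2 * M%:R + 1) * e = h' by rewrite /e; lra.
have M0 : 0 <= M%:R :> R by [].
have e0 : 0 < e.
  have : 0 < (2 * M%:R + 1) * e by rewrite eM.
  by rewrite pmulr_rgt0//; lra.
have hE : h = 2 * h' + e by rewrite /e; lra.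
rewrite (sum_ord_quads M (fun j => m (alt_tri b h' j))).
rewrite (sum_ord_pairs M (fun j => m (alt_tri b h j))).
apply: ltr_leD.
  rewrite /alt_tri/= !mul0r !mul1r.
  apply: le_lt_trans
    (@mass_upper_tri_split _ _ _ s1_neq0 s2_neq0 b h' h _ _) => //; last lra.
  apply: lerD; first apply: lerD => //.
  - by apply: mass_lower_tri_le => //; lra.
  - by apply: mass_upper_tri_le => //; lra.
apply: ler_sum => i _.
have iM : (i.+1%:R <= M%:R :> R) by rewrite ler_nat.
have i0 : 0 <= i%:R :> R by [].
have ie : i.+1%:R * e <= M%:R * e by rewrite ler_pM2r.
rewrite -[i.+1%:R]natr1 in iM ie.
have ie0 : 0 <= i%:R * e by rewrite mulr_ge0// ltW.
have ih0 : 0 <= i%:R * h' by rewrite mulr_ge0// ltW.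
rewrite /alt_tri/= !negbK !oddM/= -!natr1 !natrM.
set c := (2 * i%:R + 1) * h.
have c0 : 0 <= c by rewrite /c hE; lra.
(* Small triangle [4i+4] must move towards the origin to reach the corner [(c + h', c)]. This
   amounts to [(2i+1) * e <= h'], which [eM] provides. *)
have ch : c + h' <= (4 * i%:R + 1 + 1 + 1 + 1) * h' by rewrite /c hE; lra.
apply: lerD.
  apply: le_trans (@mass_lower_tri_split _ s1 s2 b c h' h _ _) => //; last lra.
  apply: lerD; first apply: lerD.
  - by apply: mass_lower_tri_le => //; lra.
  - by apply: mass_upper_tri_le => //; lra.
  - by apply: mass_lower_tri_le => //; lra.
(* Triangle [4i+6] is moved to the corner of large triangle [2i+2], then its leg is enlarged to
   [h]. *)
apply: le_trans (@mass_upper_triS _ s1 s2 b _ _ h' h _); last lra.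
by apply: mass_upper_tri_le => //; rewrite hE; lra.
Qed.

End alternating_sum.

(** * Cells of the quantizer and the shape of the error event *)

Section quantizer.
Context {R : realType}.
Local Notation T := (measurableTypeR R).
Variables (Q M : nat) (L : R).
Hypotheses (QM : (2 ^ Q - 1)%N = (2 * M).+1) (L0 : 0 < L).
(** Half the spacing of the levels, which are thus odd multiples of [h]. *)
Let h : R := L / (2 * M%:R + 1).
Implicit Types (b : bool) (x y : R).

Let stepE : [/\ 0 < L, 0 <= M%:R :> R, 0 < 2 * M%:R + 1 :> R, 0 < h &
  L = (2 * M%:R + 1) * h].
Proof.
have M0 : 0 <= M%:R :> R by [].
have N0 : 0 < 2 * M%:R + 1 :> R by lra.
by split; rewrite // /h ?divr_gt0// mulrC divfK// gt_eqF.
Qed.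

Lemma quantize_cell x (k : int) :
  2 * k%:~R * h <= clip L x -> clip L x < 2 * (k%:~R + 1) * h ->
  quantize Q L x = (2 * k%:~R + 1) * h.
Proof.
have [L_gt0 M0 N0 h0 LE] := stepE.
have NE : (2 ^ Q - 1)%N%:R = 2 * M%:R + 1 :> R by rewrite QM -natr1 natrM.
move=> kx xk; rewrite /quantize NE.
(* Levels are numbered from [- L], which is the centre of cell [- (M + 1)]; hence the offset
   [M + 1]. *)
have -> : Num.floor ((clip L x + L) * (2 * M%:R + 1) / (2 * L) + 2^-1) =
    k + M.+1%:Z.
  apply: floor_def.
  have -> : (clip L x + L) * (2 * M%:R + 1) / (2 * L) + 2^-1 =
      clip L x / (2 * h) + (M%:R + 1).
    by rewrite /h; field; rewrite !gt_eqF.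
  have h20 : 0 < 2 * h by lra.
  have ku : k%:~R <= clip L x / (2 * h) by rewrite ler_pdivlMr//; lra.
  have uk : clip L x / (2 * h) < k%:~R + 1 by rewrite ltr_pdivrMr//; lra.
  rewrite !rmorphD/= -pmulrn -[M.+1%:R]natr1; apply/andP; split; lra.
rewrite rmorphD/= -pmulrn -[M.+1%:R]natr1 {1 2}LE; field.
by rewrite gt_eqF.
Qed.

(** For [b = false], the negative half-line read as the positive one; ties then round down, which
    swaps the closed ends of the cells. *)
Definition mirrored_quantize b x : R :=
  if b then quantize Q L x else - quantize Q L (- x).

Lemma mirrored_quantize_cell b x (n : nat) : x <= L ->
  2 * n%:R * h < x ?<= if b -> x < 2 * (n%:R + 1) * h ?<= if ~~ b ->
  mirrored_quantize b x = (2 * n%:R + 1) * h.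
Proof.
have [L_gt0 M0 N0 h0 LE] := stepE.
move=> xL; have n0 : 0 <= n%:R * h by rewrite mulr_ge0// ltW.
rewrite /mirrored_quantize; case: b => /= nx xn.
  have cx : clip L x = x.
    rewrite /clip max_l; last lra.
    by rewrite min_l.
  by rewrite (@quantize_cell _ n%:Z) ?cx -?pmulrn.
have cx : clip L (- x) = - x.
  rewrite /clip max_l; last lra.
  by rewrite min_l//; lra.
(* Reflection sends cell [n] to cell [- (n + 1)]. *)
have nE : (- n.+1%:Z)%:~R = - (n%:R + 1) :> R by rewrite rmorphN/= -pmulrn natr1.
rewrite (@quantize_cell _ (- n.+1%:Z)) ?cx ?nE; lra.
Qed.

Lemma mirrored_quantize_clip b x : L <= x -> mirrored_quantize b x = L.
Proof.
have [L_gt0 M0 N0 h0 LE] := stepE.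
move=> Lx; rewrite /mirrored_quantize; case: b.
  have cx : clip L x = L by rewrite /clip max_l ?min_r//; lra.
  by rewrite (@quantize_cell _ M%:Z) ?cx -?pmulrn//; lra.
have cx : clip L (- x) = - L by rewrite /clip max_r ?min_l//; lra.
have ME : (- M.+1%:Z)%:~R = - (M%:R + 1) :> R by rewrite rmorphN/= -pmulrn natr1.
by rewrite (@quantize_cell _ (- M.+1%:Z)) ?cx ?ME; lra.
Qed.

Lemma cell_exists b x : 0 < x ?<= if b -> exists n : nat,
  2 * n%:R * h < x ?<= if b /\ x < 2 * (n%:R + 1) * h ?<= if ~~ b.
Proof.
have [L_gt0 M0 N0 h0 LE] := stepE.
have h20 : 0 < 2 * h by lra.
case: b => /= x0.
  have u0 : 0 <= x / (2 * h) by rewrite divr_ge0// ltW.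
  exists (Num.truncn (x / (2 * h))).
  have /andP[] := truncn_itv u0.
  rewrite -[(Num.truncn _).+1%:R]natr1 ler_pdivlMr// ltr_pdivrMr//.
  by split; lra.
have u0 : 0 < x / (2 * h) by rewrite divr_gt0.
(* Cells are closed on the right here, so the index is the ceiling minus one. *)
have := ceil_itv (x / (2 * h)); rewrite -ceil_gt0 in u0.
case: (Num.ceil _) u0 => [[|n]|]// _ /andP[].
rewrite rmorphB/= -pmulrn -[n.+1%:R]natr1 addrK ler_pdivrMr// ltr_pdivlMr// => nx xn.
by exists n; split; lra.
Qed.

(** Errors due to clipping: the quantized value is [L] and the threshold falls between [L] and x. *)
Definition far_tail b : set (T * T) :=
  [set z | L < z.2 ?<= if ~~ b /\ z.2 < z.1 ?<= if b].

Definition half_error b : set (T * T) :=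
  far_tail b `|` \big[setU/set0]_(j < (2 * M).+1) alt_tri b h j.

(* The error event restricted to [x >= 0] for [b = true], and the image under
   [z |-> - z] of its restriction to [x < 0] for [b = false]. *)
Lemma half_errorP b (z : R * R) :
  half_error b z <->
  0 < z.1 ?<= if b /\
  (z.1 < z.2 ?<= if ~~ b /\ z.2 < mirrored_quantize b z.1 ?<= if b \/
   mirrored_quantize b z.1 < z.2 ?<= if ~~ b /\ z.2 < z.1 ?<= if b).
Proof.
have [L_gt0 M0 N0 h0 LE] := stepE.
case: z => x t; rewrite /half_error -bigcup_mkord; split => /=.
  case=> [|[j /= jM]].
    rewrite /far_tail/= => -[Lt tx].
    have Lx : L <= x by case: b Lt tx => /= *; lra.
    rewrite mirrored_quantize_clip//; split; last by right.
    by case: b Lt tx => /= *; lra.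
  (* [n] is the cell whose first or second half carries triangle [j]. *)
  have [n jE] : exists n, j = (odd j + 2 * n)%N.
    by exists j./2; rewrite mul2n odd_double_half.
  have n0 : 0 <= n%:R * h by rewrite mulr_ge0// ltW.
  rewrite /alt_tri; case: ifP => oj; rewrite oj in jE.
    have nM : n%:R + 1 <= M%:R :> R.
      by rewrite natr1 ler_nat; move: jM; rewrite jE add1n ltnS ltn_mul2l.
    have nMh : (n%:R + 1) * h <= M%:R * h by rewrite ler_pM2r.
    rewrite jE add1n -natr1 natrM => -[/= nt tx xn].
    have xL : x <= L by rewrite LE; case: (b) nt tx xn => /= *; lra.
    rewrite (@mirrored_quantize_cell b x n)//; case: (b) nt tx xn => /= *; lra.
  have nM : n%:R <= M%:R :> R.
    by rewrite ler_nat; move: jM; rewrite jE add0n ltnS leq_mul2l.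
  have nMh : n%:R * h <= M%:R * h by rewrite ler_pM2r.
  rewrite jE add0n natrM => -[/= nt tx xn].
  have xL : x <= L by rewrite LE; case: (b) nt tx xn => /= *; lra.
  rewrite (@mirrored_quantize_cell b x n)//; case: (b) nt tx xn => /= *; lra.
move=> [x0 H]; have [xL|Lx] := leP x L; last first.
  left; move: H; rewrite mirrored_quantize_clip ?ltW// /far_tail/= => H.
  by case: (b) H => /= -[] [? ?]; split; lra.
have [n [nx xn]] := cell_exists x0.
move: H; rewrite (mirrored_quantize_cell xL nx xn) => -[[xt tq]|[qt tx]]; right.
  exists (2 * n)%N => /=.
    (* A cell beyond [M] would start after [L], against [x <= L]. *)
    rewrite ltnS leq_mul2l/= -(ler_nat R) leNgt; apply/negP => Mn.
    have {}Mn : M%:R + 1 <= n%:R :> R by rewrite natr1 ler_nat -(ltr_nat R).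
    have Mnh : (M%:R + 1) * h <= n%:R * h by rewrite ler_pM2r.
    by move: xL; rewrite LE; case: (b) nx => /= *; lra.
  rewrite /alt_tri oddM/= natrM.
  by split => /=; case: (b) nx xn xt tq => /= *; lra.
exists (2 * n).+1 => /=.
  (* In cell [M] or beyond the level is at least [L], leaving no room for a threshold between it and
     x. *)
  rewrite ltnS ltn_mul2l/= -(ltr_nat R) ltNge; apply/negP => Mn.
  have Mnh : M%:R * h <= n%:R * h by rewrite ler_pM2r.
  by move: xL; rewrite LE; case: (b) qt tx => /= *; lra.
rewrite /alt_tri/= oddM/= -natr1 natrM.
by split => /=; case: (b) nx xn qt tx => /= *; lra.
Qed.

End quantizer.

(** * The error probability as a sum of masses *)

Section error_mass.
Context {R : realType}.
Local Notation T := (measurableTypeR R).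
Implicit Types (b : bool) (L h : R).

Lemma measurable_far_tail L b : measurable (far_tail L b).
Proof.
rewrite (_ : far_tail L b = [set z : T * T | L < z.2 ?<= if ~~ b] `&`
  [set z : T * T | z.2 < z.1 ?<= if b])//.
by apply: measurableI; exact: measurable_lteif.
Qed.

(** Distinct triangles occupy disjoint vertical strips, so their masses add up. *)
Lemma alt_tri_band b h j (z : R * R) : 0 < h -> alt_tri b h j z ->
  j%:R * h < z.1 ?<= if b /\ z.1 < (j%:R + 1) * h ?<= if ~~ b.
Proof.
move=> h0; rewrite /alt_tri /lower_tri /upper_tri.
by case: ifP => _; case: b => /= -[? ? ?]; lra.
Qed.

Lemma measurable_half_error M L b : measurable (half_error M L b).
Proof.
apply: measurableU; first exact: measurable_far_tail.
by apply: bigsetU_measurable => j _; exact: measurable_alt_tri.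
Qed.

Lemma sgn_sub_neq (x y t : R) :
  (sgn (x - t) != sgn (y - t)) = ((t <= x) != (t <= y)).
Proof.
rewrite /sgn !subr_ge0; case: (t <= x); case: (t <= y); rewrite /= ?eqxx//.
  by apply/eqP; lra.
by apply/eqP; lra.
Qed.

Lemma error_eventE Q M L : (2 ^ Q - 1)%N = (2 * M).+1 -> 0 < L ->
  [set z : R * R | sgn (z.1 - z.2) != sgn (quantize Q L z.1 - z.2)] =
  half_error M L true `|` [set z | half_error M L false (- z.1, - z.2)].
Proof.
move=> QM L0; have hP b := @half_errorP _ _ _ _ QM L0 b; clear QM.
apply/seteqP; split=> -[x t] /=; rewrite sgn_sub_neq; last first.
  by case=> /hP[]; rewrite /mirrored_quantize /= ?opprK
    => ? [[? ?]|[? ?]];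
    case: (leP t x); case: (leP t (quantize Q L x)) => //= *; exfalso; lra.
case: (leP t x) => tx; case: (leP t (quantize Q L x)) => tq //= _;
  by have [x0|x0] := leP 0 x; [left|right]; apply/hP;
    rewrite /mirrored_quantize /= ?opprK; lra.
Qed.

Variables (s1 s2 : R).
Hypotheses (s1_neq0 : s1 != 0) (s2_neq0 : s2 != 0).
Local Notation m := (mass s1 s2).

Lemma mass_half_error M L b : 0 < L ->
  m (half_error M L b) = m (far_tail L b) +
    \sum_(j < (2 * M).+1) m (alt_tri b (L / (2 * M%:R + 1)) j).
Proof.
move=> L0; rewrite /half_error; set h := L / _.
have M0 : 0 <= M%:R :> R by [].
have N0 : 0 < 2 * M%:R + 1 :> R by lra.
have h0 : 0 < h by exact: divr_gt0.
have LE : L = (2 * M%:R + 1) * h by rewrite /h mulrC divfK// gt_eqF.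
(* Induct on the number of triangles with [h] fixed, since [h] depends on [M]. *)
suff sumE n : (n <= (2 * M).+1)%N ->
    m (far_tail L b `|` \big[setU/set0]_(j < n) alt_tri b h j) =
    m (far_tail L b) + \sum_(j < n) m (alt_tri b h j) by exact: sumE.
elim: n => [|n IH] nM; first by rewrite !big_ord0 setU0 addr0.
rewrite !big_ord_recr/= setUA massU.
- by rewrite IH ?addrA// ltnW.
- apply: measurableU; first exact: measurable_far_tail.
  by apply: bigsetU_measurable => j _; exact: measurable_alt_tri.
- exact: measurable_alt_tri.
apply/seteqP; split => // -[x t] [+ /(alt_tri_band h0)/= [nx xn]].
have nMh : (n%:R + 1) * h <= L.
  by rewrite LE ler_pM2r// -natrM !natr1 ler_nat.
rewrite -bigcup_mkord => -[|[j /= jn /(alt_tri_band h0)/= [jx xj]]].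
  by rewrite /far_tail; case: (b) nx xn => /= ? ? []; lra.
have jnh : (j%:R + 1) * h <= n%:R * h by rewrite ler_pM2r// natr1 ler_nat.
by case: (b) nx xn jx xj => /= *; lra.
Qed.

(** The parts with [x >= 0] and [x < 0] are disjoint, and reflection preserves the mass of the
    second. *)
Lemma p_errorE Q M L : (2 ^ Q - 1)%N = (2 * M).+1 -> 0 < L ->
  p_error s1 s2 L Q = (m (half_error M L true) + m (half_error M L false))%:E.
Proof.
move=> QM L0; rewrite /p_error (error_eventE QM L0).
have mh b := measurable_half_error M L b.
have mhN : measurable ([set z | half_error M L false (- z.1, - z.2)] : set (T * T)).
  exact: measurable_preimageN.
rewrite -(massN s1_neq0 s2_neq0 (mh false)) -massU//.
  by apply: massE; exact: measurableU.
apply/seteqP; split => // -[x t] [/(half_errorP QM L0)[/= x0 _]].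
by move=> /(half_errorP QM L0)[/=]; rewrite oppr_gt0 ltNge x0.
Qed.

(** The far tails are common to both sides; one more bit replaces [2 * M + 1] steps by
    [4 * M + 3]. *)
Lemma p_errorS_lt Q L : (0 < Q)%N -> 0 < L ->
  (p_error s1 s2 L Q.+1 < p_error s1 s2 L Q)%E.
Proof.
case: Q => // q _ L0; pose M := (2 ^ q - 1)%N.
have q0 : (0 < 2 ^ q)%N by rewrite expn_gt0.
have QM : (2 ^ q.+1 - 1)%N = (2 * M).+1 by rewrite /M expnS; lia.
have QM' : (2 ^ q.+2 - 1)%N = (2 * (2 * M).+1).+1 by rewrite /M !expnS; lia.
rewrite (p_errorE QM' L0) (p_errorE QM L0) lte_fin !mass_half_error//.
have step b : \sum_(j < (2 * (2 * M).+1).+1)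
      m (alt_tri b (L / (2 * (2 * M).+1%:R + 1)) j) <
    \sum_(j < (2 * M).+1) m (alt_tri b (L / (2 * M%:R + 1)) j).
  have -> : (2 * (2 * M).+1).+1 = (4 * M).+3 by lia.
  have M0 : 0 <= M%:R :> R by [].
  have -> : 2 * (2 * M).+1%:R + 1 = 4 * M%:R + 3 :> R.
    by rewrite -[(2 * M).+1%:R]natr1 natrM; ring.
  apply: sum_alt_tri_lt => //; first by apply: divr_gt0 => //; lra.
  by rewrite [LHS]mulrC [RHS]mulrC !divfK//; lra.
have := step true; have := step false; lra.
Qed.

End error_mass.

Theorem theorem3 (R : realType) (s1 s2 L : R) :
  0 < s1 -> 0 < s2 -> 0 < L ->
  forall Q Q' : nat, (1 <= Q)%N -> (Q < Q')%N -> (Q' <= 8)%N ->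
    (p_error s1 s2 L Q' < p_error s1 s2 L Q)%E.
Proof.
move=> s10 s20 L0 Q Q' Q0 QQ' _.
(* Chain the one-bit comparisons. *)
elim: Q' QQ' => // Q' IH; rewrite ltnS leq_eqVlt => /predU1P[<-|QQ'].
  by apply: p_errorS_lt; rewrite ?gt_eqF.
apply: lt_trans (IH QQ'); apply: p_errorS_lt; rewrite ?gt_eqF//.
exact: leq_trans Q0 (ltnW QQ').
Qed.
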